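(* Let $A_0,A_1,\ldots,A_n\in M_N(\mathbb C)$ be Hermitian. Then $$\inf_{Z\succ0}\lambda_{\max}\Bigl(A_0+Z+\sum_{i=1}^n A_iZ^{-1}A_i\Bigr)=\max_{C\in\mathcal D_N}\Bigl\{\operatorname{Tr}(A_0C)+2\operatorname{Tr}\bigl(E_C^{1/2}\bigr)\Bigr\},$$ where the maximum on the right is attained.
   Context: $Z\succ0$ ranges over Hermitian positive definite matrices in $M_N(\mathbb C)$; $\lambda_{\max}$ is the largest eigenvalue. $\mathcal D_N=\{C\in M_N(\mathbb C): C\succeq0,\ \operatorname{Tr}C=1\}$ is the set of density matrices. For $C\in\mathcal D_N$, $$E_C=C^{1/2}\Bigl(\sum_{i=1}^n A_iCA_i\Bigr)C^{1/2}=\sum_{i=1}^n(C^{1/2}A_iC^{1/2})^2,$$ and square roots are positive semidefinite square roots. *)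

(* Defs.v *)
From mathcomp Require Import all_boot all_order all_algebra.
From mathcomp Require Import all_classical all_reals ereal.
From mathcomp Require Import complex.

Set Implicit Arguments.
Unset Strict Implicit.
Unset Printing Implicit Defensive.

Import Order.TTheory GRing.Theory Num.Theory.

Local Open Scope ring_scope.
Local Open Scope complex_scope.
Local Open Scope sesquilinear_scope.
Local Open Scope classical_set_scope.

Section MatrixNotions.
Context {R : realType} {N : nat}.
Implicit Types A B C Z : 'M[R[i]]_N.

(* The order of R[i] is partial: 0 <= z (resp. 0 < z) says that z is a real
   number that is nonnegative (resp. positive). *)
Definition psdmx A : Prop :=
  A \is hermsymmx /\ forall v : 'cV[R[i]]_N, 0 <= (v^t* *m A *m v) 0 0.

Definition pdmx A : Prop :=
  A \is hermsymmx /\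
  forall v : 'cV[R[i]]_N, v != 0 -> 0 < (v^t* *m A *m v) 0 0.

Definition densitymx C : Prop := psdmx C /\ \tr C = 1.

(* The square root is meaningful for a positive semidefinite A; existence is
   sqrtmxP and uniqueness is sqrtmx_unique below. *)
Definition sqrtmx A : 'M[R[i]]_N :=
  xget 0 [set B : 'M[R[i]]_N | psdmx B /\ B *m B = A].

(* For Hermitian A and 0 < N, this supremum is a maximum (lambda_maxP below). *)
Definition lambda_max A : R := sup [set x : R | eigenvalue A x%:C].

Definition primal_mx n (A0 : 'M[R[i]]_N) (A : 'I_n -> 'M[R[i]]_N) Z :=
  A0 + Z + \sum_(i < n) A i *m invmx Z *m A i.

Definition E_mx n (A : 'I_n -> 'M[R[i]]_N) C :=
  sqrtmx C *m (\sum_(i < n) A i *m C *m A i) *m sqrtmx C.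

(* Both traces are real for Hermitian A0, A i and positive semidefinite C; Re
   only transports the value from R[i] to R. *)
Definition dual_obj n (A0 : 'M[R[i]]_N) (A : 'I_n -> 'M[R[i]]_N) C : R :=
  complex.Re (\tr (A0 *m C) + 2 * \tr (sqrtmx (E_mx A C))).

End MatrixNotions.

Section Facts.
Context {R : realType} {N : nat}.
Implicit Types A B C Z : 'M[R[i]]_N.

Lemma hermP A : A \is hermsymmx -> A^t* = A.
Proof. by move/is_hermitianmxP; rewrite expr0 scale1r => <-. Qed.

Lemma hermI A : A^t* = A -> A \is hermsymmx.
Proof. by move=> h; apply/is_hermitianmxP; rewrite expr0 scale1r h. Qed.

Lemma adjM m n p (X : 'M[R[i]]_(m, n)) (Y : 'M[R[i]]_(n, p)) :
  (X *m Y)^t* = Y^t* *m X^t*.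
Proof. by rewrite trmx_mul map_mxM. Qed.

Lemma adjB A B : (A - B)^t* = A^t* - B^t*.
Proof. by apply/matrixP => i j; rewrite !mxE rmorphB. Qed.

Lemma quad_diag (d : 'rV[R[i]]_N) (w : 'cV[R[i]]_N) :
  (w^t* *m diag_mx d *m w) 0 0 = \sum_i d 0 i * `|w i 0| ^+ 2.
Proof.
rewrite mxE; apply: eq_bigr => i _; rewrite mul_mx_diag !mxE normCK.
by rewrite mulrC mulrA mulrC.
Qed.

Lemma spectral_psd A : psdmx A -> forall i, 0 <= spectral_diag A 0 i.
Proof.
move=> [Ah Ap] i.
have U := spectral_unitarymx A.
have /orthomx_spectralP AE := hermitian_normalmx Ah.
have := Ap ((spectralmx A)^t* *m delta_mx i 0).
rewrite adjM trmxCK {2}AE invmx_unitary // !mulmxA.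
rewrite mulmxtVK // -(mulmxA _ (spectralmx A)) (unitarymxP U) mulmx1.
rewrite quad_diag (bigD1 i) //= big1 => [|j ji]; last first.
  by rewrite mxE (negPf ji) normr0 expr0n mulr0.
by rewrite mxE !eqxx normr1 expr1n mulr1 addr0.
Qed.

Lemma sqrtmx_exists A : psdmx A -> exists B, psdmx B /\ B *m B = A.
Proof.
move=> Ap; have d0 := spectral_psd Ap; case: Ap => Ah _.
set U := spectralmx A in d0 *; set d := spectral_diag A in d0 *.
have UU : U \is unitarymx by exact: spectral_unitarymx.
have AE : A = U^t* *m diag_mx d *m U.
  by rewrite -invmx_unitary //; exact/orthomx_spectralP/hermitian_normalmx.
pose s : 'rV[R[i]]_N := \row_i sqrtC (d 0 i).
have s0 i : 0 <= s 0 i by rewrite mxE sqrtC_ge0.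
exists (U^t* *m diag_mx s *m U); split; first split.
- apply: hermI; rewrite !adjM trmxCK mulmxA; congr (_ *m _ *m _).
  rewrite tr_diag_mx map_diag_mx; congr diag_mx; apply/rowP => i.
  by rewrite [LHS]mxE; exact: geC0_conj.
- move=> v; rewrite !mulmxA -(mulmxA _ U v) -{1}(trmxCK U) trmxCK -adjM.
  by rewrite quad_diag sumr_ge0 // => i _; rewrite mulr_ge0 // exprn_ge0.
- rewrite !mulmxA mulmxtVK // AE -(mulmxA (U^t*) (diag_mx s)) mulmx_diag.
  congr (_ *m diag_mx _ *m _); apply/rowP => i.
  by rewrite !mxE -expr2 sqrtCK.
Qed.

Lemma sqrtmxP A : psdmx A -> psdmx (sqrtmx A) /\ sqrtmx A *m sqrtmx A = A.
Proof.
by move=> /sqrtmx_exists[B BP]; rewrite /sqrtmx; case: xgetP => [|/(_ B)].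
Qed.

Lemma tr_adj_eq0 (X : 'M[R[i]]_N) : \tr (X^t* *m X) = 0 -> X = 0.
Proof.
have trE : \tr (X^t* *m X) = \sum_i \sum_j `|X j i| ^+ 2.
  apply: eq_bigr => i _; rewrite mxE; apply: eq_bigr => j _.
  by rewrite !mxE mulrC -normCK.
move/eqP; rewrite trE psumr_eq0 => [/allP h|i _]; last first.
  by apply: sumr_ge0 => j _; rewrite exprn_ge0.
apply/matrixP => j i; have := h i (mem_index_enum _).
rewrite psumr_eq0 /= => [/allP /(_ j (mem_index_enum _))|k _]; last first.
  by rewrite exprn_ge0.
by rewrite /= sqrf_eq0 normr_eq0 mxE => /eqP.
Qed.

Lemma psd_trace A (X : 'M[R[i]]_N) : psdmx A -> X^t* = X ->
  0 <= \tr (X *m A *m X) /\ (\tr (X *m A *m X) = 0 -> A *m X = 0).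
Proof.
move=> Ap Xh; have [[Bh _] BB] := sqrtmxP Ap; set B := sqrtmx A in Bh BB.
have E : X *m A *m X = (B *m X)^t* *m (B *m X).
  by rewrite adjM (hermP Bh) Xh -BB !mulmxA.
rewrite E; split; last by move/tr_adj_eq0 => h; rewrite -BB -mulmxA h mulmx0.
rewrite sumr_ge0 // => i _; rewrite mxE sumr_ge0 // => j _.
by rewrite !mxE mulrC -normCK exprn_ge0.
Qed.

Lemma sqrtmx_unique A B : psdmx B -> B *m B = A -> sqrtmx A = B.
Proof.
move=> Bp BB.
have AP : psdmx (sqrtmx A) /\ sqrtmx A *m sqrtmx A = A.
  by rewrite /sqrtmx; case: xgetP => // /(_ B) [].
case: AP; set S := sqrtmx A => Sp SS; pose X := S - B.
have Xh : X^t* = X by rewrite adjB !hermP //; [case: Bp | case: Sp].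
have XSB : S *m X + X *m B = 0.
  by rewrite mulmxBr mulmxBl SS BB addrA subrK subrr.
have [tS zS] := psd_trace Sp Xh; have [tB zB] := psd_trace Bp Xh.
have tSB : \tr (X *m S *m X) + \tr (X *m B *m X) = 0.
  rewrite -(mulmxA X S) [\tr (X *m B *m X)]mxtrace_mulC -mxtraceD -mulmxDr.
  by rewrite XSB mulmx0 mxtrace0.
move/eqP: tSB; rewrite paddr_eq0 // => /andP[/eqP/zS SX /eqP/zB BX].
have XX : X *m X = 0 by rewrite {1}/X mulmxBl SX BX subrr.
suff /eqP : X = 0 by rewrite subr_eq0 => /eqP.
by apply: tr_adj_eq0; rewrite Xh XX mxtrace0.
Qed.

Lemma lambda_maxP A : (0 < N)%N -> A \is hermsymmx ->
  eigenvalue A (lambda_max A)%:C /\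
  forall x : R, eigenvalue A x%:C -> x <= lambda_max A.
Proof.
move=> N0 Ah; set U := spectralmx A; set d := spectral_diag A.
have UU : U \is unitarymx by exact: spectral_unitarymx.
have AE : A = U^t* *m diag_mx d *m U.
  by rewrite -invmx_unitary //; exact/orthomx_spectralP/hermitian_normalmx.
have dr i : (complex.Re (d 0 i))%:C = d 0 i.
  have /mxOverP/(_ 0 i) := hermitian_spectral_diag_real Ah.
  exact: RRe_real.
have evE x : eigenvalue A x%:C -> exists i, x = complex.Re (d 0 i).
  case/eigenvalueP => v; rewrite AE !mulmxA => vA v0.
  pose w := v *m U^t*.
  have w0 : w != 0.
    apply: contra v0 => /eqP w0; rewrite -(mulmxKtV v UU) //.
    by rewrite -/w w0 mul0mx.
  have wd : w *m diag_mx d = x%:C *: w.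
    by rewrite -(mulmxtVK (w *m diag_mx d) UU) vA -scalemxAl.
  clearbody w; have /rV0Pn[i wi] := w0; exists i.
  move/rowP/(_ i): wd; rewrite mul_mx_diag !mxE mulrC => /(mulIf wi).
  by move=> ->.
have evd i : eigenvalue A (complex.Re (d 0 i))%:C.
  apply/eigenvalueP; exists (delta_mx 0 i *m U).
    rewrite AE !mulmxA mulmxtVK // dr scalemxAl; congr (_ *m _).
    apply/rowP => j; rewrite mul_mx_diag !mxE eqxx /=.
    by case: eqP => [->|]; rewrite ?mul1r ?mulr1 ?mul0r ?mulr0.
  apply/eqP => /(congr1 (fun X => X *m U^t*)); rewrite mulmxtVK // mul0mx.
  by move/rowP/(_ i)/eqP; rewrite !mxE !eqxx oner_eq0.
pose i0 := Ordinal N0.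
pose m := [arg max_(i > i0) complex.Re (d 0 i)]%O.
have mP i : complex.Re (d 0 i) <= complex.Re (d 0 m).
  by rewrite /m; case: arg_maxP => // j _; apply.
have mub : ubound [set x : R | eigenvalue A x%:C] (complex.Re (d 0 m)).
  by move=> x /= /evE[i ->].
have -> : lambda_max A = complex.Re (d 0 m).
  apply/le_anti/andP; split.
    by apply: ge_sup => //; exists (complex.Re (d 0 m)); exact: evd.
  by apply: ub_le_sup; [exists (complex.Re (d 0 m)) | exact: evd].
by split=> [|x /mub].
Qed.

Lemma E_mxE n (A : 'I_n -> 'M[R[i]]_N) C : psdmx C ->
  E_mx A C = \sum_(i < n) (sqrtmx C *m A i *m sqrtmx C) *m
                          (sqrtmx C *m A i *m sqrtmx C).
Proof.
move=> /sqrtmxP[_ CC]; rewrite /E_mx mulmx_sumr mulmx_suml.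
by apply: eq_bigr => i _; rewrite -{2}CC !mulmxA.
Qed.

End Facts.

(* Main.v *)
(** Put G(Z) = A_0 + Z + sum_i A_i Z^-1 A_i and M = sum_i A_i C A_i. For fixed C,
    Tr (C G(Z)) = Tr (A_0 C) + Tr (C Z) + Tr (M Z^-1), and the infimum over
    Z > 0 of the last two terms is 2 Tr (C^(1/2) M C^(1/2))^(1/2): a
    Cauchy-Schwarz argument bounds them from below, and
    Z^-1 = C^(1/2) (T + e)^-1 C^(1/2) + e with T = (C^(1/2) M C^(1/2))^(1/2)
    approaches the bound as e tends to 0. Hence the dual objective at C is
    inf_Z Tr (C G(Z)), which is at most p = inf_Z lambda_max (G(Z)).

    Conversely G is operator convex, so the X with X >= c (G(Z) - p) for some
    c >= 0 and Z > 0 form a convex cone; it does not contain -1. A linear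
    functional nonnegative on the cone and equal to 1 at the identity is
    Tr (C _) for a density matrix C with Tr (C G(Z)) >= p for every Z, so C is a
    maximizer of the dual problem and there is no gap; no compactness is used. *)

Require Import Defs.
From mathcomp Require Import all_boot all_order all_algebra.
From mathcomp Require Import all_classical all_reals ereal.
From mathcomp Require Import complex.
From mathcomp Require Import lra ring.

Set Implicit Arguments.
Unset Strict Implicit.
Unset Printing Implicit Defensive.

Import Order.TTheory GRing.Theory Num.Theory.

Local Open Scope ring_scope.
Local Open Scope classical_set_scope.

(** * A finite-dimensional Hahn-Banach theorem *)

Section HahnBanach.
Context {R : realType}.

(** Homogeneity is asked only as an inequality for positive factors; applying it to the inverse
    factor as well turns it into the equality [sublinearZ]. *)
Definition sublinear (V : lmodType R) (q : V -> R) : Prop :=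
  (forall x y, q (x + y) <= q x + q y) /\
  (forall t x, 0 < t -> q (t *: x) <= t * q x).

Section Sublinear.
Context {V : lmodType R}.
Implicit Types (q : V -> R) (x y v : V).

Lemma sublinear0 q : sublinear q -> q 0 = 0.
Proof.
move=> [_ qZ]; have h2 : 0 < 2 :> R by [].
have := qZ 2 0 h2; have := qZ 2^-1 0; rewrite !scaler0 invr_gt0 => /(_ h2).
by move=> ? ?; lra.
Qed.

Lemma sublinearZ q t x : sublinear q -> 0 <= t -> q (t *: x) = t * q x.
Proof.
move=> qs; rewrite le_eqVlt => /predU1P[<-|t0].
  by rewrite scale0r mul0r sublinear0.
apply/le_anti; rewrite qs.2 //= -ler_pdivlMl //.
rewrite -{1}[x](scalerK (lt0r_neq0 t0)).
by apply: qs.2; rewrite invr_gt0.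
Qed.

Lemma sublinear_opp q x : sublinear q -> - q x <= q (- x).
Proof. by move=> qs; have := qs.1 x (- x); rewrite subrr sublinear0 // => ?; lra. Qed.

(* [inf_(t >= 0) q (x + t v) - t q v] lies below [q] and is linear along [v]. *)
Lemma sublinear_reduce q v : sublinear q ->
  exists q', [/\ sublinear q', forall x, q' x <= q x & q' (- v) = - q' v].
Proof.
move=> qs.
pose S x := [set q (x + t *: v) - t * q v | t in [set t | 0 <= t]].
pose q' x := inf (S x).
have Sin x t : 0 <= t -> S x (q (x + t *: v) - t * q v) by move=> t0; exists t.
(* Subadditivity applied to t v = (x + t v) + (- x) bounds every member of [S x] from below. *)
have Slb x : lbound (S x) (- q (- x)).
  move=> _ [t /= t0 <-]; have := qs.1 (x + t *: v) (- x).
  by rewrite addrAC subrr add0r (sublinearZ _ qs) // => ?; lra.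
have Sinf x : has_inf (S x).
  by split; [exists (q (x + 0 *: v) - 0 * q v); exact: Sin | exists (- q (- x))].
have q'le x t : 0 <= t -> q' x <= q (x + t *: v) - t * q v.
  by move=> t0; apply: ge_inf; [exact: (Sinf x).2 | exact: Sin].
have q'q x : q' x <= q x.
  by have := q'le x 0 (lexx 0); rewrite scale0r addr0 mul0r subr0.
have q'ge x r : (forall t, 0 <= t -> r <= q (x + t *: v) - t * q v) -> r <= q' x.
  by move=> h; apply: lb_le_inf; [exact: (Sinf x).1 | move=> _ [t /= t0 <-]; exact: h].
have q's : sublinear q'.
  split=> [x y|s x s0].
    rewrite -lerBlDr; apply: (q'ge) => t t0; rewrite lerBlDr -lerBlDl.
    apply: (q'ge) => u u0; rewrite lerBlDl.
    apply: le_trans (q'le _ (t + u) (addr_ge0 t0 u0)) _.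
    have := qs.1 (x + t *: v) (y + u *: v).
    by rewrite scalerDl addrACA => ?; lra.
  rewrite -ler_pdivrMl //; apply: (q'ge) => t t0; rewrite ler_pdivrMl //.
  apply: le_trans (q'le _ (s * t) (mulr_ge0 (ltW s0) t0)) _.
  have := qs.2 s (x + t *: v) s0; rewrite scalerDr scalerA => ?; lra.
exists q'; split=> //; apply/le_anti; rewrite sublinear_opp // andbT.
(* The parameter t = 1 gives q' (- v) <= q 0 - q v = - q v <= - q' v. *)
have := q'le (- v) 1 ler01; rewrite scale1r addNr sublinear0 //.
have := q'q v => ? ?; lra.
Qed.

(** Oddness along the earlier vectors survives a further reduction, since q2 (- u) <= q1 (- u) = -
    q1 u <= - q2 u. *)
Lemma sublinear_reduce_seq q (s : seq V) : sublinear q ->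
  exists q', [/\ sublinear q', forall x, q' x <= q x &
    {in s, forall v, q' (- v) = - q' v}].
Proof.
move=> qs; elim: s => [|v s [q1 [q1s q1q q1N]]]; first by exists q.
have [q2 [q2s q2q q2N]] := sublinear_reduce v q1s.
exists q2; split=> // [x|u]; first exact: le_trans (q2q x) (q1q x).
rewrite inE => /predU1P[->//|us]; apply/le_anti; rewrite sublinear_opp // andbT.
have := q2q u; have := q2q (- u); have := sublinear_opp u q2s.
by have := q1N u us; have := sublinear_opp (- u) q2s; rewrite opprK; lra.
Qed.

Lemma sublinear_odd_sum q (I : Type) (r : seq I) (F : I -> V) : sublinear q ->
  (forall i, q (- F i) = - q (F i)) ->
  q (\sum_(i <- r) F i) = \sum_(i <- r) q (F i).
Proof.
move=> qs FN; elim: r => [|i r IH]; first by rewrite !big_nil sublinear0.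
rewrite !big_cons -IH; apply/le_anti; rewrite qs.1 /=.
have := qs.1 (F i + \sum_(j <- r) F j) (- F i).
by rewrite addrAC subrr add0r FN; lra.
Qed.

End Sublinear.

(** Reducing along the finitely many matrix units makes the function odd on a basis, hence linear;
    [F] collects its values on that basis. *)
Lemma sublinear_dominates_linear m n (q : 'M[R]_(m, n) -> R) : sublinear q ->
  exists F : 'M[R]_(m, n), forall X, \tr (F^T *m X) <= q X.
Proof.
move=> qs.
have [q' [q's q'q q'N]] :=
  sublinear_reduce_seq [seq delta_mx ij.1 ij.2 | ij : 'I_m * 'I_n] qs.
exists (\matrix_(i, j) q' (delta_mx i j)) => X.
apply: le_trans (q'q X); rewrite le_eqVlt; apply/orP; left; apply/eqP.
have dN i j : q' (- delta_mx i j) = - q' (delta_mx i j).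
  by apply: q'N; apply/fintype.imageP; exists (i, j).
have sN a i j : q' (a *: delta_mx i j) = a * q' (delta_mx i j).
  have [a0|a0] := lerP 0 a; first by rewrite sublinearZ.
  have na0 : 0 <= - a by rewrite oppr_ge0 ltW.
  have -> : a *: delta_mx i j = - a *: - delta_mx i j :> 'M[R]_(m, n).
    by rewrite scalerN scaleNr opprK.
  by rewrite sublinearZ // dN mulrNN.
rewrite [X in RHS]matrix_sum_delta pair_bigA /= sublinear_odd_sum //; last first.
  by move=> i; rewrite -scaleNr !sN mulNr.
rewrite -(pair_bigA _ (fun i j => q' (X i j *: delta_mx i j))) /= exchange_big.
apply: eq_bigr => j _; rewrite mxE; apply: eq_bigr => i _.
by rewrite !mxE sN mulrC.
Qed.

(** The functional is dominated by the gauge q X = inf {s | s e - X in K}. It is nonnegative on K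
    because q (- X) <= 0 there, and q e <= 1 with q (- e) <= - 1 forces the value 1 at e. *)
Lemma cone_functional m n (K : set 'M[R]_(m, n)) (e : 'M[R]_(m, n)) :
  K 0 ->
  (forall X Y, K X -> K Y -> K (X + Y)) ->
  (forall t X, 0 < t -> K X -> K (t *: X)) ->
  (forall X, exists s, K (s *: e - X)) ->
  (forall s, K (s *: e) -> 0 <= s) ->
  exists2 F : 'M[R]_(m, n), \tr (F^T *m e) = 1 &
    forall X, K X -> 0 <= \tr (F^T *m X).
Proof.
move=> K0 KD KZ Ku Kn.
pose S X := [set s | K (s *: e - X)].
pose q X := inf (S X).
have Sinf X : has_inf (S X).
  split; first exact: Ku.
  (* Adding s e - X and t e + X puts (s + t) e in K, so s >= - t. *)
  have [t Kt] := Ku (- X); exists (- t) => s Ks.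
  rewrite -subr_ge0 opprK; apply: Kn.
  by have := KD _ _ Ks Kt; rewrite opprK addrACA addNr addr0 -scalerDl.
have qle X s : K (s *: e - X) -> q X <= s.
  by move=> Ks; apply: ge_inf; [exact: (Sinf X).2|].
have qge X r : (forall s, K (s *: e - X) -> r <= s) -> r <= q X.
  by move=> h; apply: lb_le_inf; [exact: (Sinf X).1|].
have qs : sublinear q.
  split=> [X Y|t X t0].
    rewrite -lerBlDr; apply: (qge) => s Ks; rewrite lerBlDr -lerBlDl.
    apply: (qge) => t Kt; rewrite lerBlDl; apply: (qle).
    by rewrite scalerDl opprD addrACA; exact: KD.
  rewrite -ler_pdivrMl //; apply: (qge) => s Ks; rewrite ler_pdivrMl //.
  by apply: (qle); rewrite -scalerA -scalerBr; exact: KZ.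
have [F Fq] := sublinear_dominates_linear qs.
exists F.
- apply/le_anti/andP; split.
    by apply: le_trans (Fq e) _; apply: (qle); rewrite scale1r subrr.
  have := Fq (- e); rewrite mulmxN linearN /= => h.
  rewrite -lerN2; apply: le_trans h _.
  by apply: (qle); rewrite opprK scaleN1r addNr.
- move=> X KX; have := Fq (- X); rewrite mulmxN linearN /= => h.
  rewrite -oppr_le0; apply: le_trans h _.
  by apply: (qle); rewrite scale0r sub0r opprK.
Qed.

End HahnBanach.

(** * Positive matrices and the largest eigenvalue *)

Section PositiveMatrices.
Local Open Scope complex_scope.
Local Open Scope sesquilinear_scope.
Context {R : realType} {N : nat}.
Implicit Types A B C P Q T X Y Z : 'M[R[i]]_N.

Lemma adjD A B : (A + B)^t* = A^t* + B^t*.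
Proof. by apply/matrixP => i j; rewrite !mxE rmorphD. Qed.

Lemma adj_scale (a : R[i]) A : (a *: A)^t* = a^* *: A^t*.
Proof. by apply/matrixP => i j; rewrite !mxE rmorphM. Qed.

Lemma adjmx1 : (1%:M : 'M[R[i]]_N)^t* = 1%:M.
Proof. by rewrite trmx1 map_mx1. Qed.

Lemma adj_invmx A : (invmx A)^t* = invmx (A^t*).
Proof. by rewrite trmx_inv map_invmx. Qed.

Lemma tr_adj A : \tr (A^t*) = (\tr A)^*.
Proof.
by rewrite /mxtrace rmorph_sum; apply: eq_bigr => i _; rewrite !mxE.
Qed.

Lemma mxtraceB A B : \tr (A - B) = \tr A - \tr B.
Proof. exact: raddfB. Qed.

Lemma psd_adj P : psdmx P -> P^t* = P.
Proof. by case=> /hermP. Qed.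

Lemma psdI P : P^t* = P -> (forall v : 'cV_N, 0 <= (v^t* *m P *m v) 0 0) ->
  psdmx P.
Proof. by move=> /hermI. Qed.

Lemma psdD P Q : psdmx P -> psdmx Q -> psdmx (P + Q).
Proof.
move=> Pp Qp; apply: psdI => [|v]; first by rewrite adjD !psd_adj.
by rewrite mulmxDr mulmxDl mxE addr_ge0 //; [apply: Pp.2 | apply: Qp.2].
Qed.

Lemma psdZ (a : R[i]) P : 0 <= a -> psdmx P -> psdmx (a *: P).
Proof.
move=> a0 Pp; apply: psdI => [|v]; first by rewrite adj_scale geC0_conj ?psd_adj.
by rewrite -scalemxAr -scalemxAl mxE mulr_ge0 //; apply: Pp.2.
Qed.

Lemma psd_congr P X : psdmx P -> psdmx (X^t* *m P *m X).
Proof.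
move=> Pp; apply: psdI => [|v]; first by rewrite !adjM trmxCK (psd_adj Pp) mulmxA.
have -> : v^t* *m (X^t* *m P *m X) *m v = (X *m v)^t* *m P *m (X *m v).
  by rewrite adjM !mulmxA.
exact: Pp.2.
Qed.

Lemma psd_diag (d : 'rV[R[i]]_N) : (forall i, 0 <= d 0 i) -> psdmx (diag_mx d).
Proof.
move=> d0; apply: psdI => [|v].
  rewrite tr_diag_mx map_diag_mx; congr diag_mx; apply/rowP => i.
  by rewrite mxE; exact: geC0_conj.
by rewrite quad_diag sumr_ge0 // => i _; rewrite mulr_ge0 // exprn_ge0.
Qed.

Lemma psd_scalar (a : R[i]) : 0 <= a -> psdmx (a%:M : 'M[R[i]]_N).
Proof.
by move=> a0; rewrite -diag_const_mx; apply: psd_diag => i; rewrite mxE.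
Qed.

Lemma psd0 : psdmx (0 : 'M[R[i]]_N).
Proof. by have := psd_scalar (lexx (0 : R[i])); rewrite raddf0. Qed.

Lemma psd_gram X : psdmx (X^t* *m X).
Proof. by rewrite -{1}[X^t*]mulmx1; apply/psd_congr/psd_scalar. Qed.

Lemma psd_col_adj (v : 'cV[R[i]]_N) : psdmx (v *m v^t*).
Proof.
apply: psdI => [|w]; first by rewrite adjM trmxCK.
have -> : w^t* *m (v *m v^t*) *m w = (v^t* *m w)^t* *m (v^t* *m w).
  by rewrite adjM trmxCK !mulmxA.
by rewrite mxE big_ord1 !mxE mulrC -normCK exprn_ge0.
Qed.

Lemma psd_sum (I : finType) (F : I -> 'M[R[i]]_N) :
  (forall i, psdmx (F i)) -> psdmx (\sum_i F i).
Proof. by move=> Fp; apply: (big_ind (fun P => psdmx P) psd0 psdD) => i _; exact: Fp. Qed.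

Lemma psd_tr_ge0 P : psdmx P -> 0 <= \tr P.
Proof.
move=> Pp; apply: sumr_ge0 => i _.
have := Pp.2 (delta_mx i 0); rewrite -mulmxA -colE.
have -> : (delta_mx i (0 : 'I_1))^t* = delta_mx 0 i :> 'rV[R[i]]_N.
  by rewrite trmx_delta map_delta_mx.
by rewrite -rowE !mxE.
Qed.

Lemma psd_trM_ge0 P Q : psdmx P -> psdmx Q -> 0 <= \tr (P *m Q).
Proof.
move=> Pp Qp; have [Sp SS] := sqrtmxP Qp; rewrite -SS mulmxA mxtrace_mulC mulmxA.
by apply: psd_tr_ge0; rewrite -{1}(psd_adj Sp); apply: psd_congr.
Qed.

Lemma pd_psd Z : pdmx Z -> psdmx Z.
Proof.
case=> Zh Zp; split=> // v; have [->|/Zp/ltW//] := eqVneq v 0.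
by rewrite mulmx0 mxE.
Qed.

Lemma pd_unit Z : pdmx Z -> Z \in unitmx.
Proof.
case=> Zh Zp; rewrite -row_free_unit; apply: inj_row_free => v vZ.
apply/eqP; apply: contraT => v0.
have w0 : v^t* != 0.
  by apply: contra v0 => /eqP h; rewrite -[v]trmxCK h trmx0 map_mx0.
by have := Zp _ w0; rewrite trmxCK vZ mul0mx mxE ltxx.
Qed.

Lemma pd_invmx Z : pdmx Z -> pdmx (invmx Z).
Proof.
move=> Zp; have Zu := pd_unit Zp; have Zh := hermP Zp.1.
split; first by apply: hermI; rewrite adj_invmx Zh.
move=> v v0; have w0 : invmx Z *m v != 0.
  by apply: contra v0 => /eqP h; rewrite -[v](mulKVmx Zu) h mulmx0.
have := Zp.2 _ w0; rewrite adjM adj_invmx Zh.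
by rewrite -(mulmxA _ Z) (mulKVmx Zu).
Qed.

Lemma pdD_psd Z P : pdmx Z -> psdmx P -> pdmx (Z + P).
Proof.
move=> Zp Pp; split; first by apply: hermI; rewrite adjD (hermP Zp.1) psd_adj.
move=> v v0; rewrite mulmxDr mulmxDl mxE ltr_wpDr //; first exact: Pp.2.
exact: Zp.2.
Qed.

Lemma pdZ (a : R[i]) Z : 0 < a -> pdmx Z -> pdmx (a *: Z).
Proof.
move=> a0 Zp; split.
  by apply: hermI; rewrite adj_scale geC0_conj ?ltW // (hermP Zp.1).
by move=> v v0; rewrite -scalemxAr -scalemxAl mxE mulr_gt0 //; apply: Zp.2.
Qed.

Lemma quad_scalar (a : R[i]) (v : 'cV[R[i]]_N) :
  (v^t* *m a%:M *m v) 0 0 = a * \sum_i `|v i 0| ^+ 2.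
Proof.
rewrite -diag_const_mx quad_diag mulr_sumr.
by apply: eq_bigr => i _; rewrite mxE.
Qed.

Lemma pd_scalar (a : R[i]) : 0 < a -> pdmx (a%:M : 'M[R[i]]_N).
Proof.
move=> a0; have ap := psd_scalar (ltW a0); split=> [|v v0]; first exact: ap.1.
rewrite lt0r ap.2 andbT quad_scalar; apply: mulf_neq0; first exact: lt0r_neq0.
apply: contra v0; rewrite psumr_eq0 => [/allP h|i _]; last by rewrite exprn_ge0.
apply/eqP/colP => i; have := h i (mem_index_enum _).
by rewrite /= sqrf_eq0 normr_eq0 mxE => /eqP.
Qed.

End PositiveMatrices.

(** * The largest eigenvalue as a bound in the positive semidefinite order *)

Section LambdaMax.
Local Open Scope complex_scope.
Local Open Scope sesquilinear_scope.
Context {R : realType} {N : nat}.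
Implicit Types H : 'M[R[i]]_N.

Lemma spectral_diag_eigenvalue H i : H \is hermsymmx ->
  eigenvalue H (spectral_diag H 0 i).
Proof.
move=> Hh; set U := spectralmx H; set d := spectral_diag H.
have UU : U \is unitarymx by exact: spectral_unitarymx.
have HE : H = U^t* *m diag_mx d *m U.
  by rewrite -invmx_unitary //; exact/orthomx_spectralP/hermitian_normalmx.
apply/eigenvalueP; exists (delta_mx 0 i *m U).
  rewrite {1}HE !mulmxA mulmxtVK // scalemxAl; congr (_ *m _).
  apply/rowP => j; rewrite mul_mx_diag !mxE eqxx /=.
  by case: eqP => [->|]; rewrite ?mul1r ?mulr1 ?mul0r ?mulr0.
apply/eqP => /(congr1 (fun X => X *m U^t*)); rewrite mulmxtVK // mul0mx.
by move/rowP/(_ i)/eqP; rewrite !mxE !eqxx oner_eq0.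
Qed.

(** Together with [lambda_max_le], this makes [lambda_max H] the least real s with s - H positive
    semidefinite, the form in which it enters the duality argument. *)
Lemma psd_lambda_max_sub H : (0 < N)%N -> H \is hermsymmx ->
  psdmx ((lambda_max H)%:C%:M - H).
Proof.
move=> N0 Hh; have [_ lP] := lambda_maxP N0 Hh.
set U := spectralmx H; set d := spectral_diag H.
have UU : U \is unitarymx by exact: spectral_unitarymx.
have HE : H = U^t* *m diag_mx d *m U.
  by rewrite -invmx_unitary //; exact/orthomx_spectralP/hermitian_normalmx.
have -> : (lambda_max H)%:C%:M - H =
    U^t* *m diag_mx (const_mx (lambda_max H)%:C - d) *m U.
  clearbody U d; rewrite raddfB /= mulmxBr mulmxBl -HE diag_const_mx.
  rewrite mul_mx_scalar -scalemxAl -invmx_unitary // mulVmx ?unitarymx_unit //.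
  by rewrite scalemx1.
apply/psd_congr/psd_diag => i; rewrite !mxE subr_ge0.
have dr : (complex.Re (d 0 i))%:C = d 0 i.
  have /mxOverP/(_ 0 i) := hermitian_spectral_diag_real Hh.
  exact: RRe_real.
by rewrite -dr lecR; apply: lP; rewrite dr; exact: spectral_diag_eigenvalue.
Qed.

Lemma lambda_max_le H (s : R) : (0 < N)%N -> H \is hermsymmx ->
  psdmx (s%:C%:M - H) -> lambda_max H <= s.
Proof.
move=> N0 Hh sH; have [/eigenvalueP[v vH v0] _] := lambda_maxP N0 Hh.
(* Eigenvectors are row vectors here, so the quadratic form is evaluated at the adjoint of [v]. *)
have := sH.2 (v^t*); rewrite trmxCK mulmxBr vH mul_mx_scalar -scalerBl.
rewrite -scalemxAl mxE -rmorphB /=.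
have : 0 < (v *m v^t*) 0 0.
  have := (pd_scalar (N := N) (@ltr01 R[i])).2 (v^t*); rewrite trmxCK mulmx1; apply.
  by apply: contra v0 => /eqP h; rewrite -[v]trmxCK h trmx0 map_mx0.
by move=> v1; rewrite pmulr_lge0 // lecR subr_ge0.
Qed.

End LambdaMax.

(** * The variational formula for the fidelity *)

Section Fidelity.
Local Open Scope complex_scope.
Local Open Scope sesquilinear_scope.
Context {R : realType} {N : nat}.
Implicit Types A B C K Ki L Li M P Q S T U X Y Z Zi : 'M[R[i]]_N.

Lemma unitary_congrM U X Y : U \is unitarymx ->
  U^t* *m X *m U *m (U^t* *m Y *m U) = U^t* *m (X *m Y) *m U.
Proof. by move=> UU; rewrite !mulmxA mulmxtVK. Qed.

(** [D a] is U^* diag(a) U in an eigenbasis of [T]. Hiding U reduces identities between functions of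
    [T] to entrywise ones. *)
Lemma psd_functional_calculus T : psdmx T ->
  exists (D : 'rV[R[i]]_N -> 'M[R[i]]_N) (d : 'rV[R[i]]_N),
  [/\ T = D d, forall i, 0 <= d 0 i,
      forall a b, D a *m D b = D (\row_i (a 0 i * b 0 i)) &
      forall a : 'rV[R[i]]_N, (forall i, 0 <= a 0 i) -> (D a)^t* = D a].
Proof.
move=> Tp; exists (fun a => (spectralmx T)^t* *m diag_mx a *m spectralmx T).
exists (spectral_diag T).
have UU : spectralmx T \is unitarymx by exact: spectral_unitarymx.
split; [|exact: spectral_psd| |].
- rewrite -invmx_unitary //.
  by apply/orthomx_spectralP/hermitian_normalmx; case: Tp.
- by move=> a b; rewrite -mulmx_diag; exact: unitary_congrM.
- by move=> a a0; apply: psd_adj; exact/psd_congr/psd_diag.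
Qed.

Lemma psd_pseudoinverse T : psdmx T -> exists T' : 'M[R[i]]_N,
  [/\ T'^t* = T', T' *m T *m T = T & T' *m T *m T' = T'].
Proof.
move=> /psd_functional_calculus[D [d [-> d0 DM Dh]]].
(* The convention 0^-1 = 0 inverts [T] on its range and leaves its kernel in the kernel of [T']. *)
pose d' : 'rV[R[i]]_N := \row_i (d 0 i)^-1.
have dK i : d 0 i = 0 \/ (d 0 i)^-1 * d 0 i = 1.
  by have [->|h] := eqVneq (d 0 i) 0; [left | right; rewrite mulVf].
exists (D d'); rewrite !DM; split.
- by apply: Dh => i; rewrite mxE invr_ge0.
- congr D; apply/rowP => i; rewrite !mxE.
  by have [->|->] := dK i; rewrite ?mulr0 ?mul1r.
- congr D; apply/rowP => i; rewrite !mxE.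
  by have [->|->] := dK i; rewrite ?invr0 ?mulr0 ?mul1r.
Qed.

Lemma psd_idempotent_compl P : P^t* = P -> P *m P = P -> psdmx (1%:M - P).
Proof.
move=> Ph PP; have -> : 1%:M - P = (1%:M - P)^t* *m (1%:M - P).
  rewrite adjB adjmx1 Ph mulmxBl mul1mx mulmxBr mulmx1 PP subrr subr0 //.
exact: psd_gram.
Qed.

Lemma sandwich_idempotent P X Y : P *m (Y *m X) *m P = P ->
  X *m P *m Y *m (X *m P *m Y) = X *m P *m Y.
Proof. by move=> h; rewrite -[in RHS]h !mulmxA. Qed.

Lemma fidelity_square_expand S X Y Z Zi :
  Z *m Zi = 1%:M -> Zi *m Z = 1%:M ->
  (Y *m Zi - S) *m Z *m (Zi *m X - S)
    = Y *m Zi *m X - Y *m S - S *m X + S *m Z *m S.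
Proof.
move=> ZZi ZiZ; rewrite mulmxBl -(mulmxA Y Zi Z) ZiZ mulmx1.
rewrite mulmxBl (mulmxBr Y) (mulmxBr (S *m Z)) (mulmxA Y).
by rewrite -(mulmxA S Z (Zi *m X)) (mulmxA Z Zi X) ZZi mul1mx opprD opprK addrA.
Qed.

(** With Q = S K^-1 S, substituting S L^-1 S = K - e gives Q L^-1 Q = Q - e S K^-2 S, while the
    product on the right expands to L - 2 Q + Q L^-1 Q. *)
Lemma schur_identity (e : R[i]) S L Li K Ki :
  L *m Li = 1%:M -> Li *m L = 1%:M -> K *m Ki = 1%:M -> Ki *m K = 1%:M ->
  K = e%:M + S *m Li *m S ->
  L - S *m Ki *m S = (1%:M - S *m Ki *m S *m Li) *m L *m
      (1%:M - Li *m (S *m Ki *m S)) + e *: (S *m Ki *m (Ki *m S)).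
Proof.
move=> LLi LiL KKi KiK KE; set Q := S *m Ki *m S.
have QE : Q *m Li *m Q = Q - e *: (S *m Ki *m (Ki *m S)).
  have -> : Q *m Li *m Q = S *m Ki *m (S *m Li *m S) *m (Ki *m S).
    by rewrite /Q !mulmxA.
  have -> : S *m Li *m S = K - e%:M by rewrite KE addrC addKr.
  rewrite mulmxBr mulmxBl -(mulmxA S Ki K) KiK mulmx1.
  by rewrite mul_mx_scalar -scalemxAl (mulmxA S Ki S).
clearbody Q; rewrite mulmxBl mul1mx -(mulmxA Q Li L) LiL mulmx1.
rewrite mulmxBr mulmx1 mulmxBl (mulmxA L Li Q) LLi mul1mx (mulmxA Q Li Q) QE.
by rewrite subKr subrK.
Qed.

Lemma psd_sandwich A P : A^t* = A -> psdmx P -> psdmx (A *m P *m A).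
Proof. by move=> Ah Pp; rewrite -{1}Ah; exact: psd_congr. Qed.

(* With [T'] the pseudo-inverse of [T] and [W = T' S B], [tr T = tr (W B S)]
   and [W^* W] is a projection; the bound is then
   [tr (V^* Z V) >= 0] for [V = Z^-1 B W^* - S]. *)
Lemma fidelity_le C M Z : psdmx C -> psdmx M -> pdmx Z ->
  2 * \tr (sqrtmx (sqrtmx C *m M *m sqrtmx C))
    <= \tr (C *m Z) + \tr (M *m invmx Z).
Proof.
move=> Cp Mp Zp; have [Sp SS] := sqrtmxP Cp; have [Bp BB] := sqrtmxP Mp.
set S := sqrtmx C in Sp SS *; set B := sqrtmx M in Bp BB.
have Sh := psd_adj Sp; have Bh := psd_adj Bp.
have [Tp TT] := sqrtmxP (psd_sandwich Sh Mp).
set T := sqrtmx _ in Tp TT *.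
have [T' [T'h T'TT T'TT']] := psd_pseudoinverse Tp.
(* Since T^2 = (B S)^* (B S), this is the adjoint of the partial isometry in the polar decomposition
   of B S. *)
pose W := T' *m S *m B.
have Wh : W^t* = B *m S *m T' by rewrite /W !adjM T'h Bh Sh mulmxA.
have WBS : W *m B *m S = T.
  by rewrite /W -!mulmxA (mulmxA B) BB (mulmxA S) -TT mulmxA.
have trSBW : \tr (S *m (B *m W^t*)) = \tr T.
  by rewrite -[in RHS](psd_adj Tp) -WBS !adjM Bh Sh.
have Jh : (W^t* *m W)^t* = W^t* *m W by rewrite adjM trmxCK.
have JJ : W^t* *m W *m (W^t* *m W) = W^t* *m W.
  have -> : W^t* *m W = B *m S *m (T' *m T') *m (S *m B).
    by rewrite Wh /W !mulmxA.
  apply: sandwich_idempotent.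
  have -> : S *m B *m (B *m S) = T *m T by rewrite -!mulmxA (mulmxA B) BB TT mulmxA.
  rewrite -(mulmxA T' T' (T *m T)) (mulmxA T' T T) T'TT.
  by rewrite (mulmxA (T' *m T) T' T') T'TT'.
clearbody W; have Zu := pd_unit Zp; have Zih := hermP (pd_invmx Zp).1.
(* As 1 - W^* W is positive semidefinite, [h1] bounds the trace of W B Z^-1 B W^* by that of M Z^-1;
   [h2] bounds 2 tr T by the former plus tr (C Z). *)
have h1 := psd_trM_ge0 (psd_sandwich Bh (pd_psd (pd_invmx Zp)))
             (psd_idempotent_compl Jh JJ).
have h2 := psd_tr_ge0 (psd_congr (invmx Z *m (B *m W^t*) - S) (pd_psd Zp)).
have E2 : (invmx Z *m (B *m W^t*) - S)^t* *m Z *m (invmx Z *m (B *m W^t*) - S)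
   = (W *m B) *m invmx Z *m (B *m W^t*) - W *m B *m S - S *m (B *m W^t*)
     + S *m Z *m S.
  rewrite adjB !adjM Zih Sh Bh trmxCK.
  by apply: fidelity_square_expand; [exact: mulmxV | exact: mulVmx].
rewrite E2 in h2.
rewrite mulmxBr mulmx1 mxtraceB in h1.
rewrite mxtraceD !mxtraceB WBS trSBW in h2; move: h1 h2.
rewrite [\tr (B *m _ *m B)]mxtrace_mulC (mulmxA B B) BB.
have -> : \tr (B *m invmx Z *m B *m (W^t* *m W)) =
          \tr (W *m B *m invmx Z *m (B *m W^t*)).
  by rewrite (mulmxA _ (W^t*) W) [LHS]mxtrace_mulC !mulmxA.
rewrite [\tr (S *m Z *m S)]mxtrace_mulC (mulmxA S S) SS => h1 h2.
rewrite -subr_ge0; have := addr_ge0 h1 h2; congr (0 <= _); ring.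
Qed.

(* With [L = T + e], [K = S L^-1 S + e] and [Z = K^-1] one has
   [L - S Z S = D^* L D + e (Z S)^* (Z S)] for [D = 1 - L^-1 S Z S]. *)
Lemma fidelity_ge C M (r : R[i]) : psdmx C -> psdmx M ->
  (forall Z, pdmx Z -> r <= \tr (C *m Z) + \tr (M *m invmx Z)) ->
  forall e : R[i], 0 < e ->
  r <= 2 * \tr (sqrtmx (sqrtmx C *m M *m sqrtmx C)) + e * (N%:R + \tr M).
Proof.
move=> Cp Mp rP e e0; have [Sp SS] := sqrtmxP Cp.
set S := sqrtmx C in Sp SS *; have Sh := psd_adj Sp.
have [Tp TT] := sqrtmxP (psd_sandwich Sh Mp); set T := sqrtmx _ in Tp TT *.
pose L := e%:M + T; have Lp : pdmx L by apply: pdD_psd => //; exact: pd_scalar.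
have LE : L = e%:M + T by [].
clearbody L; have Lu := pd_unit Lp; have Lh := hermP Lp.1.
have Lih := hermP (pd_invmx Lp).1.
pose K := e%:M + S *m invmx L *m S.
have Kp : pdmx K.
  apply: pdD_psd; first exact: pd_scalar.
  exact: (psd_sandwich Sh (pd_psd (pd_invmx Lp))).
have KE : K = e%:M + S *m invmx L *m S by [].
clearbody K; have Ku := pd_unit Kp; have Kih := hermP (pd_invmx Kp).1.
apply: le_trans (rP _ (pd_invmx Kp)) _; rewrite invmxK.
have h1 : \tr (C *m invmx K) <= \tr L.
  pose Q := S *m invmx K *m S.
  have Qh : Q^t* = Q by rewrite /Q !adjM Kih Sh mulmxA.
  have E : L - Q = (1%:M - invmx L *m Q)^t* *m L *m (1%:M - invmx L *m Q)
       + e *: ((invmx K *m S)^t* *m (invmx K *m S)).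
    rewrite adjB adjmx1 !(adjM (invmx _)) Qh Lih Kih Sh.
    exact: (schur_identity (mulmxV Lu) (mulVmx Lu) (mulmxV Ku) (mulVmx Ku) KE).
  have : 0 <= \tr (L - Q).
    rewrite E; apply/psd_tr_ge0/psdD; first exact/psd_congr/pd_psd.
    by apply: psdZ; [exact: ltW | exact: psd_gram].
  by rewrite mxtraceB subr_ge0 /Q [\tr (S *m _ *m S)]mxtrace_mulC (mulmxA S S) SS.
have h2 : \tr (M *m K) <= \tr T + e * \tr M.
  rewrite KE mulmxDr mxtraceD mul_mx_scalar mxtraceZ addrC lerD2r.
  rewrite mulmxA mxtrace_mulC !mulmxA -TT -subr_ge0 -mxtraceB.
  (* Write T = T L L^-1 and expand L = e + T. *)
  have -> : T - T *m T *m invmx L = e *: (T *m invmx L).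
    rewrite -[X in X - _](mulmxK Lu) {1}LE mulmxDr mulmxDl addrK.
    by rewrite mul_mx_scalar scalemxAl.
  rewrite mxtraceZ mulr_ge0 //; first exact: ltW.
  exact: (psd_trM_ge0 Tp (pd_psd (pd_invmx Lp))).
apply: le_trans (lerD h1 h2) _.
rewrite LE mxtraceD mxtrace_scalar -mulr_natr le_eqVlt; apply/orP; left.
by apply/eqP; ring.
Qed.

End Fidelity.


(** * Duality *)

Section HermitianFunctional.
Local Open Scope complex_scope.
Local Open Scope sesquilinear_scope.
Context {R : realType} {N : nat}.

(** The real separation result is pulled back along [h], which maps pairs of real matrices (real and
    imaginary parts) onto the Hermitian matrices; [half] is a right inverse of [h] there. *)
Lemma herm_cone_functional (K : set 'M[R[i]]_N) :
  K 0 ->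
  (forall X Y, K X -> K Y -> K (X + Y)) ->
  (forall (t : R) X, 0 < t -> K X -> K (t%:C *: X)) ->
  (forall X, X \is hermsymmx -> exists s : R, K (s%:C%:M - X)) ->
  (forall s : R, K s%:C%:M -> 0 <= s) ->
  exists C : 'M[R[i]]_N, [/\ C \is hermsymmx, \tr C = 1 &
    forall X, X \is hermsymmx -> K X -> 0 <= \tr (C *m X)].
Proof.
move=> K0 KD KZ Ku Kn.
pose cx (X : 'M[R]_(N, N + N)) : 'M[R[i]]_N :=
  \matrix_(i, j) (X i (lshift N j) +i* X i (rshift N j)).
have cxD X Y : cx (X + Y) = cx X + cx Y.
  by apply/matrixP => i j; rewrite !mxE.
have cxZ (t : R) X : cx (t *: X) = t%:C *: cx X.
  by apply/matrixP => i j; rewrite !mxE /=; simpc.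
pose h X := cx X + (cx X)^t*.
have hD X Y : h (X + Y) = h X + h Y by rewrite /h cxD adjD addrACA.
have hZ (t : R) X : h (t *: X) = t%:C *: h X.
  rewrite /h cxZ adj_scale scalerDr; congr (_ + _ *: _).
  by rewrite conj_Creal // complex_real.
have hh X : h X \is hermsymmx by apply: hermI; rewrite adjD trmxCK addrC.
pose half (B : 'M[R[i]]_N) : 'M[R]_(N, N + N) :=
  row_mx (\matrix_(i, j) (complex.Re (B i j) / 2))
         (\matrix_(i, j) (complex.Im (B i j) / 2)).
have cx_half B : cx (half B) = (2^-1)%:C *: B.
  apply/matrixP => i j; rewrite [LHS]mxE row_mxEl row_mxEr !mxE.
  by case: (B i j) => a b /=; simpc; rewrite ![_ / 2]mulrC.
have halfK B : B \is hermsymmx -> h (half B) = B.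
  move=> Bh; rewrite /h cx_half adj_scale (hermP Bh).
  rewrite conj_Creal ?complex_real // -scalerDl -rmorphD.
  have -> : 2^-1 + 2^-1 = 1 :> R by lra.
  by rewrite rmorph1 scale1r.
pose e := half 1%:M.
have he (s : R) : h (s *: e) = s%:C%:M.
  by rewrite hZ halfK ?scalemx1 //; apply: hermI; exact: adjmx1.
have h0 : h 0 = 0 by rewrite -(scale0r 0) hZ scale0r.
have hN X : h (- X) = - h X by rewrite -scaleN1r hZ rmorphN1 scaleN1r.
have [|||||F Fe FK] := @cone_functional R N (N + N) [set X | K (h X)] e.
- by rewrite /= h0.
- by move=> X Y /= KX KY; rewrite hD; exact: KD.
- by move=> t X t0 /= KX; rewrite hZ; exact: KZ.
- by move=> X; have [s Ks] := Ku _ (hh X); exists s; rewrite /= hD hN he.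
- by move=> s /=; rewrite he; exact: Kn.
(* The sign comes from Re ((a - i b) (x + i y)) = a x + b y, and the transposition from the trace
   pairing. *)
pose C0 : 'M[R[i]]_N :=
  \matrix_(i, j) (F j (lshift N i) -i* F j (rshift N i)).
have ReD : {morph @complex.Re R : x y / x + y} by move=> [? ?] [? ?].
have C0E X : \tr (F^T *m X) = complex.Re (\tr (C0 *m cx X)).
  rewrite /mxtrace (big_morph _ ReD (erefl _)) big_split_ord /= -big_split /=.
  apply: eq_bigr => i _; rewrite !mxE (big_morph _ ReD (erefl _)) -big_split /=.
  by apply: eq_bigr => j _; rewrite !mxE /=; ring.
(* One factor 1/2 comes from taking the Hermitian part of [C0], the other from [cx (half X)] = X /
   2. *)
exists ((4^-1)%:C *: (C0 + C0^t*)).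
have CE X : X \is hermsymmx ->
    \tr ((4^-1)%:C *: (C0 + C0^t*) *m X) = (\tr (F^T *m half X))%:C.
  move=> Xh; rewrite C0E cx_half -scalemxAr linearZ /= -scalemxAl linearZ /=.
  rewrite mulmxDl linearD /=.
  have -> : \tr (C0^t* *m X) = (\tr (C0 *m X))^*.
    by rewrite -tr_adj adjM (hermP Xh) mxtrace_mulC.
  rewrite addcJ; case: (\tr _) => a b /=; simpc.
  by congr (_ +i* _); field.
have I1 : (1%:M : 'M[R[i]]_N) \is hermsymmx by apply: hermI; exact: adjmx1.
split.
- apply: hermI; rewrite adj_scale adjD trmxCK addrC conj_Creal //.
  by rewrite complex_real.
- by have := CE _ I1; rewrite mulmx1 -/e Fe.
- by move=> X Xh KX; rewrite CE // ler0c; apply: FK; rewrite /= halfK.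
Qed.

End HermitianFunctional.

(** * Operator convexity of the primal map, and the two bounds on the dual objective *)

Section Duality.
Local Open Scope complex_scope.
Local Open Scope sesquilinear_scope.
Context {R : realType} {N n : nat}.
Context (A0 : 'M[R[i]]_N) (A : 'I_n -> 'M[R[i]]_N).
Context (hA0 : A0 \is hermsymmx) (hA : forall i, A i \is hermsymmx).
Implicit Types C D X Y Z : 'M[R[i]]_N.

(** The matrix is the square (Z^-1 - Y) Z (Z^-1 - Y). For invertible [Y] it says that inversion lies
    above its tangent at Y^-1. *)
Lemma psd_invmx_tangent Y Z : Y^t* = Y -> pdmx Z ->
  psdmx (invmx Z - Y - Y + Y *m Z *m Y).
Proof.
move=> Yh Zp; have Zu := pd_unit Zp.
have := fidelity_square_expand Y 1%:M 1%:M (mulmxV Zu) (mulVmx Zu).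
rewrite !mul1mx !mulmx1 => <-.
have h : (invmx Z - Y)^t* = invmx Z - Y.
  by rewrite adjB Yh (hermP (pd_invmx Zp).1).
exact: (psd_sandwich h (pd_psd Zp)).
Qed.

(** Add the tangent inequalities at [Z1] and [Z2] for the common Y = W^-1; the weighted quadratic
    terms sum to (a + b) Y. The weights stay unnormalised to suit the cone below. *)
Lemma psd_invmx_convex (a b : R[i]) Z1 Z2 W : 0 <= a -> 0 <= b ->
  pdmx Z1 -> pdmx Z2 -> pdmx W -> (a + b) *: W = a *: Z1 + b *: Z2 ->
  psdmx (a *: invmx Z1 + b *: invmx Z2 - (a + b) *: invmx W).
Proof.
move=> a0 b0 Z1p Z2p Wp WE; set Y := invmx W.
have Yh : Y^t* = Y := hermP (pd_invmx Wp).1.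
have YWY : (a + b) *: Y = a *: (Y *m Z1 *m Y) + b *: (Y *m Z2 *m Y).
  transitivity (Y *m ((a + b) *: W) *m Y).
    by rewrite -scalemxAr (mulVmx (pd_unit Wp)) -scalemxAl mul1mx.
  by rewrite WE mulmxDr mulmxDl -!scalemxAr -!scalemxAl.
have := psdD (psdZ a0 (psd_invmx_tangent Yh Z1p))
             (psdZ b0 (psd_invmx_tangent Yh Z2p)).
congr psdmx; move: (Y *m Z1 *m Y) (Y *m Z2 *m Y) YWY => V1 V2 /matrixP VE.
apply/matrixP => i j; have := VE i j; rewrite !mxE => h.
apply/eqP; rewrite -subr_eq0; apply/eqP; move: h.
move: (invmx Z1 i j) (invmx Z2 i j) (Y i j) (V1 i j) (V2 i j) => z1 z2 y v1 v2 h.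
transitivity (a * v1 + b * v2 - (a + b) * y); first by ring.
by rewrite h subrr.
Qed.

Lemma primal_mx_herm Z : pdmx Z -> primal_mx A0 A Z \is hermsymmx.
Proof.
move=> Zp; apply: hermI; rewrite /primal_mx !adjD (hermP hA0) (hermP Zp.1).
congr (_ + _); apply: psd_adj; apply: psd_sum => i.
exact: (psd_sandwich (hermP (hA i)) (pd_psd (pd_invmx Zp))).
Qed.

Lemma sum_sandwich_lincomb (a b c : R[i]) X Y Z :
  \sum_i A i *m (a *: X + b *: Y - c *: Z) *m A i =
    a *: (\sum_i A i *m X *m A i) + b *: (\sum_i A i *m Y *m A i)
    - c *: (\sum_i A i *m Z *m A i).
Proof.
rewrite !scaler_sumr -big_split -sumrB; apply: eq_bigr => i _ /=.
by rewrite mulmxBr mulmxDr mulmxBl mulmxDl -!scalemxAr -!scalemxAl.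
Qed.

(** The terms [A0] and Z are affine and cancel, leaving the convexity gap of the inverse sandwiched
    between the [A i]. *)
Lemma primal_mx_convex (a b : R[i]) Z1 Z2 W : 0 <= a -> 0 <= b ->
  pdmx Z1 -> pdmx Z2 -> pdmx W -> (a + b) *: W = a *: Z1 + b *: Z2 ->
  psdmx (a *: primal_mx A0 A Z1 + b *: primal_mx A0 A Z2
         - (a + b) *: primal_mx A0 A W).
Proof.
move=> a0 b0 Z1p Z2p Wp WE.
have -> : a *: primal_mx A0 A Z1 + b *: primal_mx A0 A Z2
         - (a + b) *: primal_mx A0 A W
  = \sum_i (A i *m (a *: invmx Z1 + b *: invmx Z2 - (a + b) *: invmx W) *m A i).
  rewrite sum_sandwich_lincomb /primal_mx.
  move: (\sum_(i < n) A i *m invmx Z1 *m A i)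
        (\sum_(i < n) A i *m invmx Z2 *m A i)
        (\sum_(i < n) A i *m invmx W *m A i) => S1 S2 S3.
  apply/matrixP => i j.
  have /matrixP/(_ i j) := WE; rewrite !mxE => h.
  apply/eqP; rewrite -subr_eq0; apply/eqP.
  transitivity (a * Z1 i j + b * Z2 i j - (a + b) * W i j); first by ring.
  by rewrite h subrr.
apply: psd_sum => i.
exact: (psd_sandwich (hermP (hA i)) (psd_invmx_convex a0 b0 Z1p Z2p Wp WE)).
Qed.

Lemma psd_middle C : psdmx C -> psdmx (\sum_i A i *m C *m A i).
Proof.
by move=> Cp; apply: psd_sum => i; exact: (psd_sandwich (hermP (hA i)) Cp).
Qed.

Lemma tr_mul_primal_mx C Z :
  \tr (C *m primal_mx A0 A Z) = \tr (A0 *m C) +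
    (\tr (C *m Z) + \tr ((\sum_i A i *m C *m A i) *m invmx Z)).
Proof.
rewrite /primal_mx !mulmxDr !mxtraceD -addrA [\tr (A0 *m C)]mxtrace_mulC.
congr (_ + (_ + _)); rewrite mulmx_sumr mulmx_suml.
rewrite !(raddf_sum (@mxtrace _ N)); apply: eq_bigr => i _.
by rewrite -!mulmxA [RHS]mxtrace_mulC -!mulmxA.
Qed.

Lemma le_Re (x y : R[i]) : x <= y -> complex.Re x <= complex.Re y.
Proof. by rewrite lecE => /andP[]. Qed.

(** Weak duality: pairing [C] with lambda_max - G(Z) is nonnegative and tr C = 1; [fidelity_le] then
    bounds tr (C G(Z)) from below. *)
Lemma dual_obj_le_lambda_max C Z : (0 < N)%N -> densitymx C -> pdmx Z ->
  dual_obj A0 A C <= lambda_max (primal_mx A0 A Z).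
Proof.
move=> N0 [Cp trC] Zp.
have h : \tr (C *m primal_mx A0 A Z) <= (lambda_max (primal_mx A0 A Z))%:C.
  have := psd_trM_ge0 Cp (psd_lambda_max_sub N0 (primal_mx_herm Zp)).
  by rewrite mulmxBr mxtraceB mul_mx_scalar mxtraceZ trC mulr1 subr_ge0.
apply: (@le_Re _ (lambda_max (primal_mx A0 A Z))%:C); apply: le_trans h.
rewrite tr_mul_primal_mx lerD2l.
exact: (fidelity_le Cp (psd_middle Cp) Zp).
Qed.

Lemma dual_obj_ge C (p : R) : (0 < N)%N -> psdmx C ->
  (forall Z, pdmx Z -> p%:C <= \tr (C *m primal_mx A0 A Z)) ->
  p <= dual_obj A0 A C.
Proof.
move=> N0 Cp h; have Mp := psd_middle Cp.
have h1 Z : pdmx Z -> p%:C - \tr (A0 *m C)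
    <= \tr (C *m Z) + \tr ((\sum_i A i *m C *m A i) *m invmx Z).
  by move=> Zp; rewrite lerBlDl -tr_mul_primal_mx; exact: h.
have := fidelity_ge Cp Mp h1.
set w := N%:R + _ => h2.
have w0 : 0 < w by apply: ltr_pwDl; [rewrite ltr0n | exact: psd_tr_ge0].
have wE : (complex.Re w)%:C = w by apply: RRe_real; exact: gtr0_real.
clearbody w; move: (complex.Re w) wE w0 h2 => k <-; rewrite ltcR => k0 h2.
apply/ler_addgt0Pr => e e0.
(* The error in [fidelity_ge] is its parameter times k = N + tr M, so this choice makes it exactly
   [e]. *)
have := h2 (e / k)%:C; rewrite ltcR divr_gt0 // => /(_ isT).
rewrite -rmorphM /= divfK ?gt_eqF // lerBlDl addrA => /le_Re.
by rewrite /dual_obj; case: (\tr (A0 *m C) + _) => u v /=.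
Qed.

End Duality.

(** * Separation at the optimal value *)

Section Separation.
Local Open Scope complex_scope.
Local Open Scope sesquilinear_scope.
Context {R : realType} {N n : nat}.
Context (A0 : 'M[R[i]]_N) (A : 'I_n -> 'M[R[i]]_N).
Context (hA0 : A0 \is hermsymmx) (hA : forall i, A i \is hermsymmx).

(* The cone [K] is separated from [-1] at the optimal value [p] itself: [-1 \in K]
   would give a [Z] with [lambda_max < p]. *)
Lemma primal_separation (p : R) : (0 < N)%N ->
  (forall Z, pdmx Z -> p <= lambda_max (primal_mx A0 A Z)) ->
  exists2 C, densitymx C &
    forall Z, pdmx Z -> p%:C <= \tr (C *m primal_mx A0 A Z).
Proof.
move=> N0 pP; pose G Z := primal_mx A0 A Z - p%:C%:M.
have GE Z : G Z = primal_mx A0 A Z - p%:C%:M by [].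
clearbody G.
pose K := [set X : 'M[R[i]]_N | exists (c : R) Z,
  [/\ 0 <= c, pdmx Z & psdmx (X - c%:C *: G Z)]].
have p1 : pdmx (1%:M : 'M[R[i]]_N) by apply: pd_scalar.
have G0 Z X : X - 0%:C *: G Z = X by rewrite rmorph0 scale0r subr0.
have Kpsd X : psdmx X -> K X.
  by move=> Xp; exists 0, 1%:M; split; [exact: lexx | exact: p1 | rewrite G0].
have [|||||C [Ch trC CK]] := @herm_cone_functional R N K.
- exact/Kpsd/psd0.
- move=> X Y [a [Z1 [a0 Z1p XP]]] [b [Z2 [b0 Z2p YP]]].
  (* If both weights vanish there is no weighted mean to form, but then both matrices are positive
     semidefinite. *)
  have := addr_ge0 a0 b0; rewrite le_eqVlt eq_sym => /predU1P[/eqP|ab].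
    rewrite paddr_eq0 // => /andP[/eqP az /eqP bz].
    by apply: Kpsd; move: XP YP; rewrite az bz !G0; exact: psdD.
  have abC : 0 < a%:C + b%:C :> R[i] by rewrite -rmorphD ltcR.
  have aC : 0 <= a%:C :> R[i] by rewrite ler0c.
  have bC : 0 <= b%:C :> R[i] by rewrite ler0c.
  pose W : 'M[R[i]]_N := (a%:C + b%:C)^-1 *: (a%:C *: Z1 + b%:C *: Z2).
  have WE : (a%:C + b%:C) *: W = a%:C *: Z1 + b%:C *: Z2.
    by rewrite scalerA mulfV ?scale1r // gt_eqF.
  have Wp : pdmx W.
    apply: pdZ; first by rewrite invr_gt0.
    have [az|a_gt0] := eqVneq a 0.
      rewrite az rmorph0 scale0r add0r; apply: pdZ; last exact: Z2p.
      by move: ab; rewrite az add0r ltcR.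
    apply: (pdD_psd _ (psdZ bC (pd_psd Z2p))); apply: pdZ; last exact: Z1p.
    by rewrite ltcR lt_def a_gt0.
  clearbody W; exists (a + b), W; split; [exact: ltW | exact: Wp |].
  (* The two slacks plus the convexity gap make up the slack of the sum at [W]; the multiples of [p]
     cancel. *)
  have := psdD (psdD XP YP) (primal_mx_convex A0 hA aC bC Z1p Z2p Wp WE).
  congr psdmx; rewrite !GE rmorphD /=.
  move: (primal_mx A0 A Z1) (primal_mx A0 A Z2) (primal_mx A0 A W) => V1 V2 V.
  move: (a%:C) (b%:C) (p%:C%:M) => u v P.
  by apply/matrixP => i j; rewrite !mxE; ring.
- move=> t X t0 [c [Z [c0 Zp XP]]]; exists (t * c), Z; split; last first.
  + rewrite rmorphM /= -scalerA -scalerBr; apply: psdZ; last exact: XP.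
    by rewrite ler0c ltW.
  + exact: Zp.
  + by rewrite mulr_ge0 // ltW.
- by move=> X Xh; exists (lambda_max X); apply: Kpsd; exact: psd_lambda_max_sub.
- move=> s [c [Z [c0 Zp sP]]]; move: c0; rewrite le_eqVlt => /predU1P[c0|c0].
    move: sP; rewrite -c0 G0 => /psd_tr_ge0.
    by rewrite mxtrace_scalar pmulrn_lge0 // ler0c.
  (* Dividing the slack by c > 0 gives this bound, and p <= lambda_max then forces s >= 0. *)
  have h : lambda_max (primal_mx A0 A Z) <= p + s / c.
    apply: (lambda_max_le N0 (primal_mx_herm hA0 hA Zp)).
    have ci : 0 <= (c^-1)%:C :> R[i] by rewrite ler0c invr_ge0 ltW.
    have := psdZ ci sP; congr psdmx.
    rewrite scalerBr scalerA -rmorphM mulVf ?gt_eqF // rmorph1 scale1r GE.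
    have -> : (p + s / c)%:C%:M = p%:C%:M + (c^-1)%:C *: s%:C%:M :> 'M[R[i]]_N.
      by rewrite scale_scalar_mx -rmorphM -raddfD -rmorphD /= [c^-1 * s]mulrC.
    by rewrite opprB addrCA addrA.
  have := le_trans (pP _ Zp) h.
  by rewrite lerDl pmulr_lge0 // invr_gt0.
exists C.
  split; last exact: trC; split=> [|v]; first exact: Ch.
  (* Testing [C] on the rank-one matrix v v^* yields its quadratic form at [v]. *)
  have := CK _ (psd_col_adj v).1 (Kpsd _ (psd_col_adj v)).
  by rewrite mulmxA mxtrace_mulC mulmxA trace_mx11.
move=> Z Zp.
have KG : K (G Z).
  exists 1, Z; split; [exact: ler01 | exact: Zp |].
  by rewrite rmorph1 scale1r subrr; exact: psd0.
have Gh : G Z \is hermsymmx.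
  apply: hermI; rewrite GE adjB (hermP (primal_mx_herm hA0 hA Zp)).
  by rewrite -scalemx1 adj_scale adjmx1 conj_Creal // complex_real.
have := CK _ Gh KG.
by rewrite GE mulmxBr mxtraceB mul_mx_scalar mxtraceZ trC mulr1 subr_ge0.
Qed.

End Separation.

Theorem proposition3p3 (R : realType) (N n : nat) (hN : (0 < N)%N)
    (A0 : 'M[R[i]]_N) (A : 'I_n -> 'M[R[i]]_N)
    (hA0 : A0 \is hermsymmx) (hA : forall i, A i \is hermsymmx) :
  exists2 C : 'M[R[i]]_N, densitymx C &
    (forall D : 'M[R[i]]_N, densitymx D -> dual_obj A0 A D <= dual_obj A0 A C) /\
    ereal_inf [set (lambda_max (primal_mx A0 A Z))%:E | Z in [set Z | pdmx Z]]
      = (dual_obj A0 A C)%:E.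
Proof.
pose S := [set lambda_max (primal_mx A0 A Z) | Z in [set Z | pdmx Z]].
have S0 : S !=set0.
  by exists (lambda_max (primal_mx A0 A 1%:M)), 1%:M => //; exact: pd_scalar.
have weak D : densitymx D -> lbound S (dual_obj A0 A D).
  by move=> Dd _ [Z Zp <-]; exact: dual_obj_le_lambda_max.
have Slb : has_lbound S.
  (* The maximally mixed density matrix gives a finite lower bound, so the real infimum of [S] is a
     genuine one. *)
  exists (dual_obj A0 A (N%:R^-1)%:M); apply: weak; split.
    by apply: psd_scalar; rewrite invr_ge0 ler0n.
  by rewrite mxtrace_scalar -[LHS]mulr_natr mulVf // pnatr_eq0 -lt0n.
have [|C Cd CP] := primal_separation hA0 hA hN (p := inf S).
  by move=> Z Zp; apply: ge_inf => //; exists Z.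
have SC : inf S <= dual_obj A0 A C by apply: dual_obj_ge => //; exact: Cd.1.
have weakS D : densitymx D -> dual_obj A0 A D <= inf S.
  by move=> Dd; apply: lb_le_inf => //; exact: weak.
exists C => //; split=> [D Dd|]; first exact: le_trans (weakS _ Dd) SC.
have -> : dual_obj A0 A C = inf S by apply/le_anti; rewrite weakS.
(* For a nonempty set bounded below, the extended infimum is the real one. *)
by rewrite -ereal_inf_EFin // -image_comp.
Qed.
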